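(* Let $N\ge2$ and let $V\in C((0,+\infty))$ be increasing and nonconstant. Let $u\in C(\mathbb{R}^N)\cap C^2(\mathbb{R}^N\setminus\{0\})$ be a solution of $$\begin{cases}-\Delta u+V(|x|)u=u\log u^2,\\ u>0,\quad u(x)\to0\ \text{ as } |x|\to\infty.\end{cases}$$ Then $u$ is radially symmetric about $0$. Moreover, $u'(r)<0$ for each $r>0$.
   Context: ''Increasing'' is in the non-strict sense. $u'(r)$ is the derivative of the radial profile $u(r)=u(|x|)$. Since $V$ is defined only on $(0,\infty)$ and $u$ is $C^2$ only away from the origin, the equation is understood pointwise in $\mathbb{R}^N\setminus\{0\}$. *)

(* Defs.v *)
From HB Require Import structures.
From mathcomp Require Import all_boot all_order all_algebra.
From mathcomp Require Import all_classical all_reals all_analysis.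

Set Implicit Arguments.
Unset Strict Implicit.
Unset Printing Implicit Defensive.

Import Order.TTheory GRing.Theory Num.Theory.
Import numFieldNormedType.Exports.

Local Open Scope classical_set_scope.
Local Open Scope ring_scope.

(* The library norm `|x| on 'rV[R]_n is the sup norm, hence this definition;
   both norms induce the same topology. *)
Definition enorm (R : realType) (n : nat) (x : 'rV[R]_n) : R :=
  Num.sqrt (\sum_(i < n) x ord0 i ^+ 2).

Definition partial (R : realType) (n : nat) (i : 'I_n) (f : 'rV[R]_n -> R) :
    'rV[R]_n -> R :=
  'D_(delta_mx ord0 i) f.

Definition has_partial (R : realType) (n : nat) (i : 'I_n)
    (f : 'rV[R]_n -> R) (x : 'rV[R]_n) : Prop :=
  derivable f x (delta_mx ord0 i).

Definition laplacian (R : realType) (n : nat) (f : 'rV[R]_n -> R) :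
    'rV[R]_n -> R :=
  fun x => \sum_(i < n) partial i (partial i f) x.

(* Meant for open A, so that continuity at the points of A coincides with
   continuity of the restriction to A. *)
Definition C2_on (R : realType) (n : nat) (A : set 'rV[R]_n)
    (f : 'rV[R]_n -> R) : Prop :=
  [/\ forall x, A x -> {for x, continuous f},
      forall i x, A x ->
        has_partial i f x /\ {for x, continuous (partial i f)}
    & forall i j x, A x ->
        has_partial j (partial i f) x /\
        {for x, continuous (partial j (partial i f))}].

Definition vanishes_at_infinity (R : realType) (n : nat)
    (f : 'rV[R]_n -> R) : Prop :=
  forall e : R, 0 < e ->
    exists M : R, forall x : 'rV[R]_n, M <= enorm x -> `|f x| < e.

(* Main.v *)
Require Import Defs.
From HB Require Import structures.
From mathcomp Require Import all_boot all_order all_algebra.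
From mathcomp Require Import all_classical all_reals all_analysis.
From mathcomp Require Import ring lra.

(* Moving planes.  For a unit vector e and l > 0 let w = u o sigma - u on the
   half-space {x . e > l}, where sigma is the reflection in {x . e = l}.  As
   |sigma x| < |x| there, V increasing and convexity of s |-> s log s^2 give
       Delta w <= (V(|x|) - 2 log u - 2) w       away from sigma 0.
   The coefficient is positive where u is small, so a negative minimum of w lies in
   a ball independent of l and e, and w >= 0 for large l.  Let l0 be the supremum
   of the levels l at which w takes a negative value; if such levels exist, then at
   l0 we have w >= 0, and w is not identically 0 since otherwise V(r + 2 l0) = V(r)
   for all r > 0 and V would be constant.  Comparison with a Gaussian barrier on
   annuli then gives w > 0 in the half-space and, at the boundary, D_e u < 0 (Hopf),
   which excludes negative values at levels close to l0.  The point sigma 0, where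
   w is only continuous, is removable for the comparison principle.  Letting l -> 0
   for e parallel to x - y shows u x <= u y whenever |x| = |y|, and D_e u < 0 on
   {x . e = r} is the strict monotonicity of the profile. *)

Set Implicit Arguments.
Unset Strict Implicit.
Unset Printing Implicit Defensive.

Import Order.TTheory GRing.Theory Num.Theory.
Import numFieldNormedType.Exports.

Local Open Scope classical_set_scope.
Local Open Scope ring_scope.

(** * One-variable calculus *)

Section OneVariable.
Context {R : realType}.
Implicit Types (F G : R -> R) (a b d t x : R).

Lemma is_derive_remainder F x d :
  (forall e, 0 < e -> \forall t \near (0 : R), `|F (x + t) - F x - d * t| <= e * `|t|) ->
  is_derive x 1 F d.
Proof.
move=> H.
have C : h^-1 *: ((F \o shift x) (h *: 1) - F x) @[h --> (0:R)^'] --> d.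
  apply/cvgrPdist_le => e e0; rewrite near_withinE.
  near=> t => t0; rewrite /= [t%:A]mulr1.
  rewrite -[_ *: _]/(_ * _) (addrC t x).
  have -> : d - t^-1 * (F (x + t) - F x) = - (F (x + t) - F x - d * t) / t by field.
  rewrite normrM normfV normrN ler_pdivrMr ?normr_gt0//.
  by near: t; exact: H.
by apply: DeriveDef; [apply/cvg_ex; exists d | exact/cvg_lim].
Unshelve. all: by end_near. Qed.

Lemma mean_value_at0 F G (h : R) :
  (forall s : R, `|s| <= `|h| -> is_derive s 1 F (G s)) ->
  exists2 c, `|c| <= `|h| & F h - F 0 = G c * h.
Proof.
move=> D.
have cF s : `|s| <= `|h| -> {for s, continuous F}.
  by move=> /D [dF _]; apply/differentiable_continuous/derivable1_diffP.
have [h0|h0|->] := ltgtP h 0; last first.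
- by exists 0; rewrite ?normr0// subrr mulr0.
- have [||c c0h E] := @MVT R F G 0 h h0.
  + move=> s; rewrite in_itv/= => /andP[? ?]; apply: D.
    by rewrite !ger0_norm ?ltW.
  + apply/continuous_in_subspaceT => s; rewrite inE/= in_itv/= => /andP[? ?].
    by apply: cF; rewrite !ger0_norm// ltW.
  exists c; last by rewrite E subr0.
  by move: c0h; rewrite in_itv/= => /andP[? ?]; rewrite !ger0_norm ?ltW.
- have [||c c0h E] := @MVT R F G h 0 h0.
  + move=> s; rewrite in_itv/= => /andP[? ?]; apply: D.
    by rewrite !ler0_norm ?ltW// ltrN2.
  + apply/continuous_in_subspaceT => s; rewrite inE/= in_itv/= => /andP[? ?].
    by apply: cF; rewrite !ler0_norm// ?lerN2// ltW.
  exists c; last by rewrite -opprB E; ring.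
  by move: c0h; rewrite in_itv/= => /andP[? ?]; rewrite !ler0_norm ?lerN2 ?ltW.
Qed.

Definition second_deriv0 F a :=
  exists F1 : R -> R, (\forall t \near (0 : R), is_derive (t : R) 1 F (F1 t)) /\ is_derive (0 : R) 1 F1 a.

Lemma second_deriv0D F G a b : second_deriv0 F a -> second_deriv0 G b ->
  second_deriv0 (fun t => F t + G t) (a + b).
Proof.
move=> [F1 [nF dF]] [G1 [nG dG]]; exists (fun t => F1 t + G1 t); split.
  by near=> t; apply: is_deriveD; near: t.
exact: is_deriveD.
Unshelve. all: by end_near. Qed.

Lemma second_deriv0Z F a (k : R) : second_deriv0 F a ->
  second_deriv0 (fun t => k * F t) (k * a).
Proof.
move=> [F1 [nF dF]]; exists (fun t => k * F1 t); split.
  by near=> t; apply: is_deriveZ; near: t.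
exact: is_deriveZ.
Unshelve. all: by end_near. Qed.

Lemma second_deriv0_max F a : second_deriv0 F a ->
  (\forall t \near (0 : R), F t <= F 0) -> a <= 0.
Proof.
move=> [F1 [nF dF]] nM; rewrite leNgt; apply/negP => a0.
have [d d0 Hd] : exists2 d, 0 < d &
    forall t : R, `|t| < d -> is_derive t 1 F (F1 t) /\ F t <= F 0.
  have /nbhs_ballP[d d0 Hd] : \forall t \near (0:R), is_derive (t : R) 1 F (F1 t) /\ F t <= F 0.
    by near=> t; split; near: t.
  exists d => // t td; have := Hd t; apply.
  by rewrite /ball/= sub0r normrN.
have F10 : F1 0 = 0.
  have D0 : is_derive (0:R) 1 F 0.
    apply: (@derive1_at_max R F (- d) d 0).
    - by rewrite lerNl (le_trans _ (ltW d0))// oppr_le0 ltW.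
    - by move=> t; rewrite in_itv/= -ltr_norml => /Hd[[]].
    - by rewrite in_itv/= oppr_lt0 d0.
    - by move=> t; rewrite in_itv/= -ltr_norml => /Hd[].
  have [|D1 _] := Hd 0; first by rewrite normr0.
  by rewrite -(@derive_val _ _ _ _ _ _ _ D1) (@derive_val _ _ _ _ _ _ _ D0).
have /cvgrPdist_lt/(_ (a / 2)) : h^-1 *: ((F1 \o shift 0) (h *: 1) - F1 0) @[h --> (0:R)^'] --> a.
  have [cF1 EF1] := dF; rewrite -EF1; exact: cF1.
rewrite divr_gt0// => /(_ isT); rewrite near_withinE => /nbhs_ballP[d' d'0 Hd'].
pose m := Num.min d d' / 2.
have m0 : 0 < m by rewrite divr_gt0// lt_min d0.
have mm : m < Num.min d d' by rewrite /m ltr_pdivrMr// ltr_pMr ?ltr1n// lt_min d0.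
have F1pos t : 0 < t -> t <= m -> 0 < F1 t.
  move=> t0 tm; have := Hd' t; rewrite /ball/= sub0r normrN gtr0_norm//.
  have td' : t < d' by rewrite (le_lt_trans tm)// (lt_le_trans mm)// ge_min lexx orbT.
  move=> /(_ td' (lt0r_neq0 t0)); rewrite /= [t%:A]mulr1 addr0 F10 subr0 => H.
  have : a / 2 < t^-1 *: F1 t by move: H; rewrite ltr_norml => /andP[_ ?]; lra.
  rewrite -[_ *: _]/(_ * _) => H1; have : 0 < t^-1 * F1 t by rewrite (lt_trans _ H1)// divr_gt0.
  by rewrite pmulr_rgt0// invr_gt0.
have md : m < d by rewrite (lt_le_trans mm)// ge_min lexx.
have [||c] := @MVT R F F1 0 m m0.
- move=> s; rewrite in_itv/= => /andP[s0 sm].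
  by have [] := Hd s; rewrite // gtr0_norm// (lt_trans sm).
- apply/continuous_in_subspaceT => s; rewrite inE/= in_itv/= => /andP[s0 sm].
  have [|[dFs _] _] := Hd s; first by rewrite ger0_norm// (le_lt_trans sm).
  exact/differentiable_continuous/derivable1_diffP.
rewrite in_itv/= => /andP[c0 cm] E.
have [|_] := Hd m; first by rewrite gtr0_norm.
rewrite -subr_le0 E subr0 leNgt mulr_gt0//; apply: F1pos => //; exact: ltW.
Unshelve. all: by end_near. Qed.

End OneVariable.

Section Lines.
Context {R : realType} {N : nat}.
Implicit Types (f : 'rV[R]_N -> R) (x y v b : 'rV[R]_N).

Lemma near_line x v (P : set 'rV[R]_N) :
  (\forall z \near x, P z) -> \forall t \near (0 : R), P (x + t *: v).
Proof.
move=> nP; have C : (fun t : R => x + t *: v) @ (0 : R) --> x.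
  suff : (fun t : R => x + t *: v) @ (0 : R) --> x + 0 *: v by rewrite scale0r addr0.
  by apply: cvgD; [exact: cvg_cst|exact: scalel_continuous].
exact: C.
Qed.

Lemma is_derive_line f x v (s : R) : derivable f (x + s *: v) v ->
  is_derive s 1 (fun t : R => f (x + t *: v)) ('D_v f (x + s *: v)).
Proof.
move=> df.
have E : (fun h : R => h^-1 *: (((fun t => f (x + t *: v)) \o shift s) (h *: (1 : R)) - f (x + s *: v)))
    = (fun h : R => h^-1 *: ((f \o shift (x + s *: v)) (h *: v) - f (x + s *: v))).
  apply/funext => h /=; congr (_ *: (f _ - _)).
  by rewrite [_%:A]mulr1 scalerDl addrCA.
by apply: DeriveDef; rewrite /derivable /derive E.
Qed.

Local Notation "''e_' i" := (delta_mx ord0 i : 'rV[R]_N) (at level 8, i at level 2).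

Lemma is_derive_coord_step f y i b (c : R) :
  (\forall z \near y, has_partial i f z) -> {for y, continuous (partial i f)} ->
  is_derive (0 : R) 1
    (fun t : R => f (y + t *: b + (t * c) *: 'e_i) - f (y + t *: b)) (c * partial i f y).
Proof.
move=> np cp; apply: is_derive_remainder => e e0.
have c1 : 0 < `|c| + 1 by rewrite ltr_wpDl.
have [d d0 Hd] : exists2 d, 0 < d & forall z, `|z - y| < d ->
    has_partial i f z /\ `|partial i f z - partial i f y| <= e / (`|c| + 1).
  have /nbhs_ballP[d d0 Hd] : \forall z \near y, has_partial i f z /\
      `|partial i f z - partial i f y| <= e / (`|c| + 1).
    near=> z; split; first by near: z.
    rewrite distrC; near: z; move/cvgrPdist_le : cp; apply.
    by rewrite divr_gt0.
  exists d => // z zd; apply: Hd; by rewrite -ball_normE /ball_/= distrC.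
pose m := `|b| + `|c| * `|'e_i| + 1.
have m0 : 0 < m by rewrite ltr_wpDl// addr_ge0// mulr_ge0.
near=> t.
have tm : `|t| * m < d.
  rewrite -ltr_pdivlMr//; near: t.
  have : 0 < d / m by rewrite divr_gt0.
  move=> dm; apply/nbhs_ballP; exists (d / m) => // t.
  by rewrite /ball/= sub0r normrN.
have close s : `|s| <= `|t * c| -> `|y + t *: b + s *: 'e_i - y| < d.
  move=> stc; rewrite addrAC (addrC y) addrK (le_lt_trans _ tm)//.
  rewrite (le_trans (ler_normD _ _))// !normrZ.
  apply: (@le_trans _ _ (`|t| * `|b| + `|t * c| * `|'e_i|)).
    by rewrite lerD2l ler_wpM2r.
  by rewrite normrM /m -mulrA -mulrDr ler_wpM2l// lerDl.
have [|s st E] := @mean_value_at0 R (fun s => f (y + t *: b + s *: 'e_i))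
    (fun s => partial i f (y + t *: b + s *: 'e_i)) (t * c).
  by move=> s /close/Hd[hp _]; exact: is_derive_line.
rewrite add0r !scale0r !mul0r scale0r !addr0 subrr subr0.
move: E; rewrite scale0r addr0 => ->.
have [_ Hs] := Hd _ (close _ st).
set p := partial i f _ in Hs *.
rewrite (_ : p * (t * c) - _ = (p - partial i f y) * c * t); last by ring.
rewrite normrM ler_wpM2r// normrM (le_trans (ler_wpM2r _ Hs))//.
by rewrite mulrAC ler_pdivrMr// ler_pM2l// lerDl.
Unshelve. all: by end_near. Qed.

(* Moving from y to y + t a one coordinate at a time. *)
Lemma is_derive_C1 f y (a : 'rV[R]_N) :
  (forall i, \forall z \near y, has_partial i f z) ->
  (forall i, {for y, continuous (partial i f)}) ->
  is_derive (0 : R) 1 (fun t : R => f (y + t *: a)) (\sum_i a ord0 i * partial i f y).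
Proof.
move=> np cp; rewrite [X in fun t : R => f (_ + _ *: X)]row_sum_delta.
elim: (index_enum _) => [|i s IH].
  rewrite !big_nil.
  by under [X in is_derive _ _ X _]eq_fun do rewrite scaler0 addr0; exact: is_derive_cst.
rewrite !big_cons.
have D := is_deriveD IH (is_derive_coord_step (\sum_(j <- s) a ord0 j *: 'e_j) (a ord0 i) (np i) (cp i)).
rewrite [X in is_derive _ _ _ X]addrC; set g := (X in is_derive _ _ X _).
suff -> : g = (fun t : R => f (y + t *: \sum_(j <- s) a ord0 j *: 'e_j)) +
  (fun t : R => f (y + t *: \sum_(j <- s) a ord0 j *: 'e_j + (t * a ord0 i) *: 'e_i) -
     f (y + t *: \sum_(j <- s) a ord0 j *: 'e_j)) by exact: D.
apply/funext => t /=; rewrite /g.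
rewrite fctE scalerDr scalerA [RHS]addrC subrK; congr f.
by rewrite -!addrA; congr (_ + _); exact: addrC.
Qed.

End Lines.

(** * Euclidean structure of row vectors *)

Section Euclidean.
Context {R : realType} {N : nat}.
Implicit Types (x y z v c e : 'rV[R]_N).

Definition dot x y : R := \sum_i x ord0 i * y ord0 i.
Definition dist2 x y : R := dot (x - y) (x - y).

Lemma dotC x y : dot x y = dot y x.
Proof. by apply: eq_bigr => i _; rewrite mulrC. Qed.

Lemma dotDl x y z : dot (x + y) z = dot x z + dot y z.
Proof. by rewrite /dot -big_split; apply: eq_bigr => i _; rewrite mxE mulrDl. Qed.

Lemma dotZl (k : R) x y : dot (k *: x) y = k * dot x y.
Proof. by rewrite /dot mulr_sumr; apply: eq_bigr => i _; rewrite mxE mulrA. Qed.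

Lemma dotNl x y : dot (- x) y = - dot x y.
Proof. by rewrite -scaleN1r dotZl mulN1r. Qed.

Lemma dotDr x y z : dot x (y + z) = dot x y + dot x z.
Proof. by rewrite dotC dotDl !(dotC x). Qed.

Lemma dotZr (k : R) x y : dot x (k *: y) = k * dot x y.
Proof. by rewrite dotC dotZl (dotC x). Qed.

Lemma dotNr x y : dot x (- y) = - dot x y.
Proof. by rewrite dotC dotNl (dotC x). Qed.

Lemma dot0l x : dot 0 x = 0.
Proof. by rewrite -(scale0r (0 : 'rV[R]_N)) dotZl mul0r. Qed.

Definition dotE := (dotDl, dotDr, dotNl, dotNr, dotZl, dotZr).

Lemma dot_delta x i : dot x (delta_mx ord0 i) = x ord0 i.
Proof.
rewrite /dot (bigD1 i)//= big1 => [|j ji]; rewrite !mxE ?eqxx ?mulr1 ?addr0//.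
by rewrite (negbTE ji) andbF mulr0.
Qed.

Lemma dot_ge0 x : 0 <= dot x x.
Proof. by apply: sumr_ge0 => i _; rewrite -expr2 sqr_ge0. Qed.

Lemma dot_eq0 x : (dot x x == 0) = (x == 0).
Proof.
apply/idP/eqP => [|->]; last by rewrite dot0l.
rewrite psumr_eq0 => [/allP x0|i _]; last by rewrite -expr2 sqr_ge0.
apply/rowP => i; rewrite mxE; have := x0 i.
by rewrite mem_index_enum mulf_eq0 orbb => /(_ isT)/eqP.
Qed.

Lemma dot_gt0 x : (0 < dot x x) = (x != 0).
Proof. by rewrite lt0r dot_ge0 dot_eq0 andbT. Qed.

Lemma enormE x : enorm x = Num.sqrt (dot x x).
Proof. by congr Num.sqrt; apply: eq_bigr => i _; rewrite expr2. Qed.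

Lemma enorm_ge0 x : 0 <= enorm x. Proof. exact: sqrtr_ge0. Qed.

Lemma sqr_enorm x : enorm x ^+ 2 = dot x x.
Proof. by rewrite enormE sqr_sqrtr ?dot_ge0. Qed.

Lemma enorm_gt0 x : (0 < enorm x) = (x != 0).
Proof. by rewrite enormE sqrtr_gt0 dot_gt0. Qed.

Lemma enormN x : enorm (- x) = enorm x.
Proof. by rewrite !enormE !dotE opprK. Qed.

Lemma enormZ (k : R) x : enorm (k *: x) = `|k| * enorm x.
Proof. by rewrite !enormE !dotE mulrA -expr2 sqrtrM ?sqr_ge0// sqrtr_sqr. Qed.

Lemma ler_enorm x y : (enorm x <= enorm y) = (dot x x <= dot y y).
Proof. by rewrite -!sqr_enorm ler_sqr ?nnegrE ?enorm_ge0. Qed.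

Lemma le_dot_enorm x e : dot e e = 1 -> dot x e <= enorm x.
Proof.
move=> e1; apply: le_trans (ler_norm _) _.
rewrite -ler_sqr ?nnegrE ?enorm_ge0// sqr_enorm real_normK ?num_real//.
have := dot_ge0 (x - dot x e *: e); rewrite !dotE e1 (dotC e x) => H.
by rewrite expr2; lra.
Qed.

Lemma enormD x y : enorm (x + y) <= enorm x + enorm y.
Proof.
rewrite -ler_sqr ?nnegrE ?addr_ge0 ?enorm_ge0// sqrrD !sqr_enorm !dotE (dotC y x).
suff : dot x y <= enorm x * enorm y by rewrite -mulr_natl; lra.
have [->|y0] := eqVneq y 0.
  by rewrite dotC dot0l mulr_ge0 ?enorm_ge0.
have y1 : enorm y != 0 by rewrite gt_eqF// enorm_gt0.
have := @le_dot_enorm x ((enorm y)^-1 *: y).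
rewrite !dotE -sqr_enorm expr2 mulKf// mulVf// => /(_ erefl).
by rewrite mulrC ler_pdivrMr// enorm_gt0.
Qed.

Lemma enorm_coord x i : `|x ord0 i| <= enorm x.
Proof.
rewrite -ler_sqr ?nnegrE ?enorm_ge0// sqr_enorm real_normK ?num_real//.
by rewrite /dot (bigD1 i)//= -expr2 lerDl sumr_ge0// => j _; rewrite -expr2 sqr_ge0.
Qed.

Lemma dist2_gt0 x y : (0 < dist2 x y) = (x != y).
Proof. by rewrite dot_gt0 subr_eq0. Qed.

Lemma dist2_ge0 x y : 0 <= dist2 x y. Proof. exact: dot_ge0. Qed.

Lemma dist2_line x c v (t : R) :
  dist2 (x + t *: v) c = dist2 x c + t * (2 * dot (x - c) v) + t * t * dot v v.
Proof. by rewrite /dist2 !dotE (dotC v x) (dotC v c) (dotC c x); ring. Qed.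

Lemma continuous_sumr (I : Type) (r : seq I) (f : I -> 'rV[R]_N -> R) x :
  (forall i, {for x, continuous (f i)}) ->
  {for x, continuous (fun z => \sum_(i <- r) f i z)}.
Proof.
move=> cf; elim: r => [|i r IH].
  suff -> : (fun z => \sum_(i <- [::]) f i z) = cst (0 : R) by exact: cst_continuous.
  by apply/funext => z; rewrite big_nil.
suff -> : (fun z => \sum_(j <- i :: r) f j z) = (fun z => f i z + \sum_(j <- r) f j z).
  exact: continuousD (cf i) IH.
by apply/funext => z; rewrite big_cons.
Qed.

Lemma dot_continuous y : continuous (dot ^~ y).
Proof.
move=> x; apply: continuous_sumr => i; apply: continuousM; last exact: cst_continuous.
exact: coord_continuous.
Qed.

Lemma dist2_continuous c : continuous (dist2 ^~ c).
Proof.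
move=> x; apply: continuous_sumr => i.
have cc : {for x, continuous (fun z : 'rV[R]_N => (z - c) ord0 i)}.
  have -> : (fun z : 'rV[R]_N => (z - c) ord0 i) = (fun z => z ord0 i - c ord0 i).
    by apply/funext => z; rewrite !mxE.
  by apply: continuousB; [exact: coord_continuous|exact: cst_continuous].
exact: continuousM.
Qed.

Lemma near_neq x c : x != c -> \forall z \near x, z != c.
Proof.
rewrite -dist2_gt0 => xc; near=> z; rewrite -dist2_gt0; near: z.
by move: (xc); apply: cvgr_gt; exact: dist2_continuous.
Unshelve. all: by end_near. Qed.

Lemma compact_dist2 c (r : R) (A : set 'rV[R]_N) :
  closed A -> (forall x, A x -> dist2 x c <= r) -> compact A.
Proof.
move=> cA Ar; apply: bounded_closed_compact => //.
exists (Num.sqrt r + `|c|); split; first exact: num_real.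
move=> M rM x /Ar xr /=; apply: (le_trans _ (ltW rM)).
rewrite -[x](subrK c) (le_trans (ler_normD _ _))// lerD2r.
rewrite -[X in X <= _]/(mx_norm (x - c)) mx_normrE; apply/bigmax_leP; split => [|[i j] _ /=].
  exact: sqrtr_ge0.
rewrite ord1 (le_trans (enorm_coord _ _))// enormE.
by rewrite ler_sqrt// (le_trans _ xr)// dist2_ge0.
Qed.

End Euclidean.

(** * Laplacians and reflections *)

Section Laplacian.
Context {R : realType} {N : nat}.
Implicit Types (f g : 'rV[R]_N -> R) (x y z v c e : 'rV[R]_N) (L : R).

Local Notation "''e_' i" := (delta_mx ord0 i : 'rV[R]_N) (at level 8, i at level 2).

(* Only the restrictions of f to coordinate lines matter, so that compositions with
   isometries need no Hessian. *)
Definition has_lap f x L := exists a : 'I_N -> R,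
  (forall k, second_deriv0 (fun t => f (x + t *: 'e_k)) (a k)) /\ \sum_k a k = L.

Lemma has_lapD f g x L M : has_lap f x L -> has_lap g x M ->
  has_lap (fun z => f z + g z) x (L + M).
Proof.
move=> [a [fa <-]] [b [gb <-]]; exists (fun k => a k + b k).
by rewrite big_split; split => // k; exact: second_deriv0D.
Qed.

Lemma has_lapZ f x L (k : R) : has_lap f x L -> has_lap (fun z => k * f z) x (k * L).
Proof.
move=> [a [fa <-]]; exists (fun i => k * a i).
by rewrite mulr_sumr; split => // i; exact: second_deriv0Z.
Qed.

Lemma has_lapB f g x L M : has_lap f x L -> has_lap g x M ->
  has_lap (fun z => f z - g z) x (L - M).
Proof.
move=> fL /(has_lapZ (-1)); rewrite mulN1r => gM.
have -> : (fun z => f z - g z) = (fun z => f z + -1 * g z).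
  by apply/funext => z; rewrite mulN1r.
exact: has_lapD.
Qed.

Lemma has_lap_max f x L : has_lap f x L -> (\forall z \near x, f z <= f x) -> L <= 0.
Proof.
move=> [a [fa <-]] fx; apply: sumr_le0 => k _.
apply: (second_deriv0_max (fa k)).
by rewrite scale0r addr0; exact: (near_line 'e_k fx).
Qed.

Lemma second_deriv0_quad (g g1 : R -> R) (g2 s y : R) :
  (\forall r \near s, is_derive (r : R) 1 g (g1 r)) -> is_derive s 1 g1 g2 ->
  second_deriv0 (fun t => g (s + t * (2 * y) + t * t))
    (g2 * (2 * y) ^+ 2 + 2 * g1 s).
Proof.
move=> ng dg; pose p (t : R) := s + t * (2 * y) + t * t.
have dp (t : R) : is_derive t 1 p (2 * y + 2 * t).
  have D := is_deriveD (is_deriveD (is_derive_cst s t 1)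
    (is_deriveM (is_derive_id t 1) (is_derive_cst (2 * y) t 1)))
    (is_deriveM (is_derive_id t (1 : R)) (is_derive_id t 1)).
  apply: (is_derive_eq D).
  by rewrite /GRing.scale/= /cst; ring.
have p0 : p 0 = s by rewrite /p !mul0r !addr0.
exists (fun t => g1 (p t) * (2 * y + 2 * t)); split.
  have cp : {for 0, continuous p}.
    by have [d _] := dp 0; apply/differentiable_continuous/derivable1_diffP.
  have : \forall t \near (0 : R), is_derive (p t) 1 g (g1 (p t)).
    by rewrite -p0 in ng; exact: (cp _ ng).
  by apply: filterS => t dgt; exact: is_derive1_comp.
rewrite -p0 in dg.
have D2 : is_derive (0 : R) 1 (fun t : R => 2 * y + 2 * t) 2.
  have D := is_deriveD (is_derive_cst (2 * y) (0 : R) 1) (is_deriveM (is_derive_cst (2 : R) (0 : R) 1) (is_derive_id (0 : R) (1 : R))).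
  by apply: (is_derive_eq D); rewrite /GRing.scale/= /cst; ring.
have D := is_deriveM (is_derive1_comp (f := g1) (g := p) dg (dp 0)) D2.
by apply: (is_derive_eq D); rewrite /GRing.scale/= p0; ring.
Qed.

Lemma has_lap_dist2 (g g1 : R -> R) (g2 : R) x c :
  (\forall s \near dist2 x c, is_derive (s : R) 1 g (g1 s)) ->
  is_derive (dist2 x c) 1 g1 g2 ->
  has_lap (fun z => g (dist2 z c)) x (4 * dist2 x c * g2 + 2 * N%:R * g1 (dist2 x c)).
Proof.
move=> ng dg.
exists (fun k => g2 * (2 * (x - c) ord0 k) ^+ 2 + 2 * g1 (dist2 x c)); split.
  move=> k.
  have -> : (fun t => g (dist2 (x + t *: 'e_k) c)) = (fun t => g (dist2 x c + t * (2 * (x - c) ord0 k) + t * t)).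
    have ek1 : dot 'e_k 'e_k = 1 :> R by rewrite dot_delta mxE !eqxx.
    by apply/funext => t; rewrite dist2_line ek1 dot_delta mulr1.
  exact: second_deriv0_quad.
rewrite big_split/= sumr_const card_ord -mulr_sumr.
have -> : \sum_k (2 * (x - c) ord0 k) ^+ 2 = 4 * dist2 x c.
  by rewrite /dist2 /dot mulr_sumr; apply: eq_bigr => k _; ring.
by rewrite -mulr_natr; ring.
Qed.

Lemma has_lap_gauss (al : R) x c :
  has_lap (fun z => expR (- al * dist2 z c)) x
   ((4 * al ^+ 2 * dist2 x c - 2 * N%:R * al) * expR (- al * dist2 x c)).
Proof.
have D (s : R) : is_derive s 1 (fun s => expR (- al * s)) (- al * expR (- al * s)).
  have D1 : is_derive s 1 (fun s : R => - al * s) (- al).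
    have D := is_deriveM (is_derive_cst (- al) s 1) (is_derive_id s 1).
    by apply: (is_derive_eq D); rewrite /GRing.scale/= /cst; ring.
  have D2 := is_derive1_comp (f := expR) (is_derive_expR (- al * s)) D1.
  by apply: (is_derive_eq D2); rewrite mulrC.
have D2 (s : R) : is_derive s 1 (fun s => - al * expR (- al * s)) (- al * (- al * expR (- al * s))).
  exact: (is_deriveZ (- al) (D s)).
have nD : \forall s \near dist2 x c,
    is_derive (s : R) 1 (fun s => expR (- al * s)) (- al * expR (- al * s)).
  by near=> s; exact: D.
have := has_lap_dist2 nD (D2 _).
by congr has_lap; ring.
Unshelve. all: by end_near. Qed.

Lemma has_lap_ln (q : R) x c : 0 < q ->
  has_lap (fun z => ln (dist2 z c + q)) x
    ((2 * N%:R * (dist2 x c + q) - 4 * dist2 x c) / (dist2 x c + q) ^+ 2).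
Proof.
move=> q0.
have Dq (s : R) : is_derive s 1 (fun s : R => s + q) 1.
  have D := is_deriveD (is_derive_id s (1:R)) (is_derive_cst q s 1).
  by apply: (is_derive_eq D); rewrite addr0.
have D (s : R) : 0 < s + q -> is_derive s 1 (fun s => ln (s + q)) (s + q)^-1.
  move=> sq; have D2 := is_derive1_comp (f := @ln R) (g := fun s => s + q) (is_derive1_ln sq) (Dq s).
  by apply: (is_derive_eq D2); rewrite mulr1.
have s0 : 0 < dist2 x c + q by rewrite ltr_wpDl// dist2_ge0.
have nD : \forall s \near dist2 x c, is_derive (s : R) 1 (fun s => ln (s + q)) (s + q)^-1.
  have : - q < dist2 x c by lra.
  move=> /lt_nbhsr; apply: filterS => s sq; apply: D; lra.
have D2 : is_derive (dist2 x c) 1 (fun s => (s + q)^-1) (- (dist2 x c + q) ^- 2).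
  have [d1 e1] := Dq (dist2 x c).
  have dq := derivableV (f := fun s : R => s + q) (lt0r_neq0 s0) d1.
  apply: DeriveDef; first exact: dq.
  have := deriveV (f := fun s : R => s + q) (lt0r_neq0 s0) d1.
  by rewrite e1 /GRing.scale/= mulr1 => <-.
have := has_lap_dist2 nD D2.
by congr has_lap; field; rewrite lt0r_neq0.
Qed.

End Laplacian.

Section Frames.
Context {R : realType} {N : nat}.
Variables (f : 'rV[R]_N -> R) (A : set 'rV[R]_N).
Hypotheses (openA : forall y, A y -> \forall z \near y, A z) (fC2 : C2_on A f).
Implicit Types (x y z v e : 'rV[R]_N).

Definition dir_deriv e x : R := \sum_i e ord0 i * partial i f x.

Lemma dir_continuous e x : A x -> {for x, continuous (dir_deriv e)}.
Proof.
move=> Ax; apply: continuous_sumr => i.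
apply: continuousM; first exact: cst_continuous.
by have [_ /(_ i x Ax)[]] := fC2.
Qed.

Lemma is_derive_dir x e (t : R) : A (x + t *: e) ->
  is_derive t 1 (fun s : R => f (x + s *: e)) (dir_deriv e (x + t *: e)).
Proof.
move=> Axt; set y := x + t *: e.
have D : is_derive (0 : R) 1 (fun s : R => f (y + s *: e)) (dir_deriv e y).
  have [_ f1 _] := fC2; apply: is_derive_C1 => i; last by have [] := f1 i y Axt.
  by apply: filterS (openA Axt) => z /(f1 i)[].
have E : (fun h : R => h^-1 *: (((fun s => f (x + s *: e)) \o shift t) (h *: (1 : R)) - f (x + t *: e)))
    = (fun h : R => h^-1 *: (((fun s => f (y + s *: e)) \o shift 0) (h *: (1 : R)) - f (y + 0 *: e))).
  apply/funext => h /=; rewrite !addr0 scale0r addr0 /y; congr (_ *: (f _ - _)).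
  by rewrite scalerDl addrCA addrC.
by case: D => D1 D2; apply: DeriveDef; rewrite /derivable /derive E.
Qed.

Lemma second_deriv0_dir x e : A x ->
  second_deriv0 (fun t => f (x + t *: e))
    (\sum_i e ord0 i * \sum_j e ord0 j * partial j (partial i f) x).
Proof.
move=> Ax; exists (fun t => dir_deriv e (x + t *: e)); split.
  by apply: filterS (near_line e (openA Ax)) => t; exact: is_derive_dir.
have [_ _ f2] := fC2.
have D i : is_derive (0 : R) 1 (fun t : R => e ord0 i * partial i f (x + t *: e))
    (e ord0 i * \sum_j e ord0 j * partial j (partial i f) x).
  apply: is_deriveZ; apply: is_derive_C1 => j; last by have [] := f2 i j x Ax.
  by apply: filterS (openA Ax) => z /(f2 i j)[].
have := is_derive_sum D.
suff -> : \sum_(i < N) (fun t : R => e ord0 i * partial i f (x + t *: e)) =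
  (fun t : R => dir_deriv e (x + t *: e)) by [].
by apply/funext => t; rewrite fct_sumE.
Qed.

Lemma lap_frame x (e : 'I_N -> 'rV[R]_N) : A x ->
  (forall i j, \sum_k e k ord0 i * e k ord0 j = (i == j)%:R) ->
  exists a : 'I_N -> R, (forall k, second_deriv0 (fun t => f (x + t *: e k)) (a k)) /\
    \sum_k a k = laplacian f x.
Proof.
move=> Ax eE; exists (fun k => \sum_i e k ord0 i * \sum_j e k ord0 j * partial j (partial i f) x).
split=> [k|]; first exact: second_deriv0_dir.
rewrite exchange_big; apply: eq_bigr => i _.
under eq_bigr do rewrite mulr_sumr.
rewrite exchange_big (bigD1 i)//= [X in _ + X]big1 => [|j ji].
  under eq_bigr do rewrite mulrA.
  by rewrite -mulr_suml eE eqxx mul1r addr0.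
under eq_bigr do rewrite mulrA.
by rewrite -mulr_suml eE eq_sym (negbTE ji) mul0r.
Qed.

Lemma has_laplacian x : A x -> has_lap f x (laplacian f x).
Proof.
move=> Ax; apply: (lap_frame (e := fun k => delta_mx ord0 k)) => // i j.
rewrite (bigD1 i)//= big1 => [|k ki]; rewrite !mxE ?eqxx ?mul1r ?addr0//.
  by rewrite eq_sym.
by rewrite [i == k]eq_sym (negbTE ki) mul0r.
Qed.

End Frames.

Section Reflection.
Context {R : realType} {N : nat}.
Implicit Types (x y z v e : 'rV[R]_N) (l : R).

(* Reflection in the hyperplane [dot x e = l], for a unit vector e. *)
Definition refl e l x := x - (2 * (dot x e - l)) *: e.

Lemma dot_refl e l x : dot e e = 1 -> dot (refl e l x) e = 2 * l - dot x e.
Proof. by move=> e1; rewrite !dotE e1; ring. Qed.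

Lemma reflK e l : dot e e = 1 -> involutive (refl e l).
Proof.
move=> e1 x; rewrite {1}/refl dot_refl// /refl -addrA -opprD -scalerDl.
by rewrite [X in X *: _](_ : _ = 0) ?scale0r ?subr0//; ring.
Qed.

Lemma dot_refl_refl e l x : dot e e = 1 ->
  dot (refl e l x) (refl e l x) = dot x x - 4 * l * (dot x e - l).
Proof. by move=> e1; rewrite !dotE e1 (dotC e x); ring. Qed.

Lemma refl_fix e l x : dot x e = l -> refl e l x = x.
Proof. by move=> xe; rewrite /refl xe subrr mulr0 scale0r subr0. Qed.

Lemma refl_line e l x v (t : R) :
  refl e l (x + t *: v) = refl e l x + t *: (v - (2 * dot v e) *: e).
Proof.
by apply/rowP => i; rewrite /refl !mxE !dotE; ring.
Qed.

Lemma refl_continuous2 e x l :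
  {for (x, l), continuous (fun p : 'rV[R]_N * R => refl e p.2 p.1)}.
Proof.
apply: (@continuousB _ _ _ (fun p => p.1) (fun p => (2 * (dot p.1 e - p.2)) *: e)).
  exact: cvg_fst.
apply: (@continuousZr_tmp _ _ _ (fun p => 2 * (dot p.1 e - p.2))); apply: continuousM; first exact: cst_continuous.
apply: (@continuousB _ _ _ (fun p => dot p.1 e) (fun p => p.2)); last exact: cvg_snd.
by apply: (@continuous_comp _ _ _ fst (fun z => dot z e)); [exact: cvg_fst|exact: dot_continuous].
Qed.

Lemma refl_continuous e l : continuous (refl e l).
Proof.
move=> x; apply: (@continuousB _ _ _ id (fun p => (2 * (dot p e - l)) *: e)).
  exact: cvg_id.
apply: (@continuousZr_tmp _ _ _ (fun p => 2 * (dot p e - l))); apply: continuousM; first exact: cst_continuous.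
by apply: (@continuousB _ _ _ (fun p => dot p e) (cst l)); [exact: dot_continuous|exact: cst_continuous].
Qed.

Lemma refl_continuous_level e x : continuous (fun l => refl e l x).
Proof.
move=> l; apply: (@continuousB _ _ _ (cst x) (fun l => (2 * (dot x e - l)) *: e)).
  exact: cst_continuous.
apply: (@continuousZr_tmp _ _ _ (fun l => 2 * (dot x e - l))); apply: continuousM; first exact: cst_continuous.
by apply: (@continuousB _ _ _ (cst (dot x e)) id); [exact: cst_continuous|exact: cvg_id].
Qed.

Lemma has_lap_refl (f : 'rV[R]_N -> R) (A : set 'rV[R]_N) e l x :
  (forall y, A y -> \forall z \near y, A z) -> C2_on A f -> dot e e = 1 ->
  A (refl e l x) -> has_lap (f \o refl e l) x (laplacian f (refl e l x)).
Proof.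
move=> oA fC2 e1 Ax.
have [|a [fa <-]] := lap_frame (e := fun k => delta_mx ord0 k - (2 * e ord0 k) *: e) oA fC2 Ax.
  move=> i j.
  under eq_bigr => k _.
    rewrite !mxE/= (_ : _ * _ = (i == k)%:R * (j == k)%:R - 2 * e ord0 j * ((i == k)%:R * e ord0 k)
      - 2 * e ord0 i * ((j == k)%:R * e ord0 k) + 4 * e ord0 i * e ord0 j * (e ord0 k * e ord0 k)); last by ring.
    over.
  have sel (m : 'I_N) (F : 'I_N -> R) : \sum_k (m == k)%:R * F k = F m.
    rewrite (bigD1 m)//= big1 => [|k km]; rewrite ?eqxx ?mul1r ?addr0//.
    by rewrite eq_sym (negbTE km) mul0r.
  rewrite !big_split/= !sumrN -!mulr_sumr !sel -/(dot e e) e1 eq_sym; ring.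
exists a; split => // k.
under [X in second_deriv0 X]eq_fun do rewrite /= refl_line dotC dot_delta.
exact: fa.
Qed.

End Reflection.

(** * Comparison principle and Hopf lemma *)

Section Comparison.
Context {R : realType} {N : nat}.
Hypothesis N2 : (2 <= N)%N.
Implicit Types (x y z c : 'rV[R]_N) (f h psi : 'rV[R]_N -> R) (K U : set 'rV[R]_N).

Lemma max_on_compact K f : compact K -> K !=set0 -> continuous f ->
  exists2 x, K x & forall z, K z -> f z <= f x.
Proof.
move=> cK K0 cf; have [x xK xmax] := EVT_max_rV K0 cK (continuous_subspaceT cf).
by exists x => [|z Kz]; [exact: set_mem|apply: xmax; exact: mem_set].
Qed.

Lemma min_on_compact K f : compact K -> K !=set0 -> continuous f ->
  exists2 x, K x & forall z, K z -> f x <= f z.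
Proof.
move=> cK K0 cf; have [x xK xmin] := EVT_min_rV K0 cK (continuous_subspaceT cf).
by exists x => [|z Kz]; [exact: set_mem|apply: xmin; exact: mem_set].
Qed.

(* The point z0 is removable because eta * ln (|x - z0|^2 + q) is subharmonic in
   dimension at least 2 and, as q -> 0, tends to -oo at z0 only. *)
Lemma comparison_punctured K U (C : R) z0 h psi :
  compact K -> (forall x, U x -> \forall z \near x, K z) -> 0 < C ->
  continuous h -> continuous psi ->
  (forall x, K x -> ~ U x -> h x <= psi x) ->
  (forall x, U x -> exists2 L, has_lap h x L & C * h x <= L) ->
  (forall x, U x -> x != z0 -> exists2 L, has_lap psi x L & L <= C * psi x) ->
  forall y, K y -> y != z0 -> h y <= psi y.
Proof.
move=> cK UK C0 ch cpsi bd lh lpsi y Ky yz0; rewrite leNgt; apply/negP => hy.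
have K0 : K !=set0 by exists y.
have [xM _ HM] := max_on_compact cK K0 (fun x => continuousB (ch x) (cpsi x)).
have [xL _ HL] := max_on_compact cK K0 (@dist2_continuous R N z0).
set M := (h - psi) xM in HM; set d := h y - psi y.
have d0 : 0 < d by rewrite subr_gt0.
have M0 : 0 < M by rewrite (lt_le_trans d0)// (HM y).
pose Lam := dist2 xL z0 + 1.
have Lam1 : 1 <= Lam by rewrite lerDr dist2_ge0.
have lnLam : 0 <= ln Lam by exact: ln_ge0.
have ys : 0 < dist2 y z0 by rewrite dist2_gt0.
pose w := 1 + `|ln Lam - ln (dist2 y z0)|.
have w0 : 0 < w by rewrite ltr_wpDr.
pose eta := d / w.
have eta0 : 0 < eta by rewrite divr_gt0.
have etad : eta * (ln Lam - ln (dist2 y z0)) < d.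
  apply: (@le_lt_trans _ _ (eta * `|ln Lam - ln (dist2 y z0)|)).
    by rewrite ler_pM2l// ler_norm.
  by rewrite /eta mulrAC ltr_pdivrMr// ltr_pM2l// ltrDr.
pose q := expR (- (M / eta)).
have q0 : 0 < q := expR_gt0 _.
have q1 : q <= 1 by rewrite -expR0 ler_expR oppr_le0 divr_ge0 ?ltW.
have sq0 x : 0 < dist2 x z0 + q by rewrite ltr_wpDl// dist2_ge0.
have lnq x : K x -> ln (dist2 x z0 + q) <= ln Lam.
  by move=> Kx; rewrite ler_ln ?posrE ?(lt_le_trans _ Lam1)// lerD// HL.
pose g x := (h x - psi x) + eta * ln (dist2 x z0 + q).
have cg : continuous g.
  move=> x; apply: (@continuousD _ _ _ (fun x => h x - psi x) (fun x => eta * ln (dist2 x z0 + q))).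
    by apply: continuousB; [exact: ch|exact: cpsi].
  apply: (@continuousM _ _ (cst eta) (fun x => ln (dist2 x z0 + q))); first exact: cst_continuous.
  apply: (@continuous_comp _ _ _ (fun x => dist2 x z0 + q) (@ln R)); last exact: continuous_ln.
  by apply: (@continuousD _ _ _ (fun x => dist2 x z0) (cst q)); [exact: dist2_continuous|exact: cst_continuous].
have [x Kx xmax] := max_on_compact cK K0 cg.
have gx : eta * ln Lam < g x.
  apply: lt_le_trans (xmax _ Ky); rewrite /g -/d.
  have : ln (dist2 y z0) <= ln (dist2 y z0 + q) by rewrite ler_ln ?posrE// lerDl ltW.
  rewrite -(ler_pM2l eta0) => H; move: etad; rewrite mulrBr; lra.
have hx : psi x < h x.
  have := lnq _ Kx; rewrite -(ler_pM2l eta0) => H; move: gx; rewrite /g; lra.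
have Ux : U x by apply: contrapT => nUx; have := bd _ Kx nUx; rewrite leNgt hx.
have xz0 : x != z0.
  apply/eqP => xz; move: gx; rewrite /g [in dist2 _ _]xz /dist2 subrr.
  have qM : eta * - (M / eta) = - M by field; rewrite gt_eqF.
  rewrite dot0l add0r /q expRK qM => H.
  have H2 : h x - psi x <= M := HM _ Kx.
  have : 0 <= eta * ln Lam by rewrite mulr_ge0// ltW.
  lra.
have [Lh hLh CLh] := lh _ Ux; have [Lp hLp CLp] := lpsi _ Ux xz0.
have hL := has_lapD (has_lapB hLh hLp) (has_lapZ eta (has_lap_ln x z0 q0)).
have := has_lap_max hL; rewrite leNgt => Hmax.
have /negP : ~~ (0 < Lh - Lp + eta * ((2 * N%:R * (dist2 x z0 + q) - 4 * dist2 x z0) / (dist2 x z0 + q) ^+ 2)).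
  by apply: Hmax; apply: filterS (UK _ Ux) => z Kz; exact: xmax.
apply; apply: ltr_wpDr; last first.
  rewrite subr_gt0 (le_lt_trans CLp)// (lt_le_trans _ CLh)// ltr_pM2l//.
rewrite mulr_ge0 ?(ltW eta0)// divr_ge0 ?sqr_ge0//.
have N2R : (2 : R) <= N%:R by rewrite ler_nat.
have : 0 <= (N%:R - 2) * (dist2 x z0 + q) by rewrite mulr_ge0 ?subr_ge0// ltW.
lra.
Qed.

End Comparison.

Section HopfLemma.
Context {R : realType} {N : nat}.
Hypothesis N2 : (2 <= N)%N.
Implicit Types (x y z c p e : 'rV[R]_N) (psi : 'rV[R]_N -> R) (a b C l : R).

Lemma near_dist2 x (P : set 'rV[R]_N) : (\forall z \near x, P z) ->
  exists2 a, 0 < a & forall z, dist2 z x <= a -> P z.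
Proof.
move=> /nbhs_ballP[d d0 Hd]; exists ((d / 2) ^+ 2); first by rewrite exprn_gt0// divr_gt0.
move=> z; rewrite /dist2 -sqr_enorm ler_sqr ?nnegrE ?enorm_ge0 ?divr_ge0 ?(ltW d0)// => zx.
apply: Hd; split => // i j; rewrite ord1 -ball_normE /ball_/= distrC.
have := enorm_coord (z - x) j; rewrite !mxE => H.
by rewrite (le_lt_trans H)// (le_lt_trans zx)// ltr_pdivrMr// ltr_pMr// ltr1n.
Qed.

Lemma le0_punctured x (f : 'rV[R]_N -> R) : {for x, continuous f} ->
  (\forall z \near x, z != x -> f z <= 0) -> f x <= 0.
Proof.
move=> cf nf; rewrite leNgt; apply/negP => fx.
have n0 : \forall z \near x, 0 < f z by move: cf => /cvgr_gt; apply.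
pose v : 'rV[R]_N := const_mx 1.
have v0 : v != 0.
  apply/eqP => /rowP/(_ (Ordinal (ltnW N2))); rewrite !mxE => /eqP.
  by rewrite oner_eq0.
have := near_line v nf; have := near_line v n0 => L1 L2.
have /nbhs_ballP[d d0 Hd] : \forall t \near (0:R), 0 < f (x + t *: v) /\ (x + t *: v != x -> f (x + t *: v) <= 0).
  by near=> t; split; near: t.
have [|f0 fN] := Hd (d / 2).
  rewrite /ball/= sub0r normrN gtr0_norm ?divr_gt0//.
  by rewrite ltr_pdivrMr// ltr_pMr// ltr1n.
have := fN _; rewrite leNgt f0 => /(_ _)/negP; apply => //.
by rewrite -subr_eq0 addrC addKr scaler_eq0 negb_or v0 gt_eqF// divr_gt0.
Unshelve. all: by end_near. Qed.

Lemma annulus_barrier a b C z0 c psi :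
  0 < a -> a < b -> 0 < C -> continuous psi ->
  (forall x, a <= dist2 x c <= b -> 0 <= psi x) ->
  (forall x, dist2 x c = a -> 0 < psi x) ->
  (forall x, a < dist2 x c < b -> x != z0 -> exists2 L, has_lap psi x L & L <= C * psi x) ->
  exists m al, [/\ 0 < m, 0 < al & forall x, a <= dist2 x c <= b ->
    m * (expR (- al * dist2 x c) - expR (- al * b)) <= psi x].
Proof.
move=> a0 ab C0 cpsi psi0 psia psiL.
have b0 := lt_trans a0 ab.
have [m m0 Hm] : exists2 m, 0 < m & forall x, dist2 x c = a -> m <= psi x.
  have [S0|S0] := pselect ([set x | dist2 x c = a] !=set0); last first.
    by exists 1 => // x xa; case: S0; exists x.
  have cS : compact [set x : 'rV[R]_N | dist2 x c = a].
    apply: (@compact_dist2 _ _ c a); last by move=> x /= ->.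
    by apply: (@preimage_closed _ _ (dist2 ^~ c) [set a]);
      [move=> x _; exact: dist2_continuous|exact: closed_eq].
  have [x xa Hx] := min_on_compact cS S0 cpsi.
  by exists (psi x); [exact: psia|exact: Hx].
pose al := (2 * N%:R + C) / (4 * a) + 1.
have NC : 0 < 2 * N%:R + C :> R by rewrite ltr_wpDl// mulr_ge0.
have al0 : 0 < al by rewrite ltr_wpDl// divr_ge0// ?mulr_ge0// ltW.
have alC : C <= 4 * al ^+ 2 * a - 2 * N%:R * al.
  have E : 4 * a * al = 2 * N%:R + C + 4 * a by rewrite /al; field; rewrite gt_eqF.
  have al1 : 1 <= al by rewrite lerDr divr_ge0// ?mulr_ge0// ltW.
  have -> : 4 * al ^+ 2 * a - 2 * N%:R * al = al * (4 * a * al - 2 * N%:R) by ring.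
  rewrite E; have : 1 * (C + 4 * a) <= al * (C + 4 * a) by rewrite ler_wpM2r// addr_ge0 ?mulr_ge0 ?ltW.
  rewrite mul1r => H; have -> : 2 * N%:R + C + 4 * a - 2 * N%:R = C + 4 * a by ring.
  lra.
exists m, al; split => //.
pose K := [set x : 'rV[R]_N | a <= dist2 x c <= b].
pose U := [set x : 'rV[R]_N | a < dist2 x c < b].
pose h x := m * (expR (- al * dist2 x c) - expR (- al * b)).
have clK : closed K.
  rewrite (_ : K = (dist2 ^~ c) @^-1` [set` `[a, b]]); last first.
    by apply/seteqP; split => x /=; rewrite in_itv.
  apply: preimage_closed; first by move=> x _; exact: dist2_continuous.
  exact: interval_closed.
have cK : compact K by apply: (@compact_dist2 _ _ c b) => // x /andP[].
have UK x : U x -> \forall z \near x, K z.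
  move=> /andP[ax xb]; near=> z; apply/andP; split; apply/ltW; near: z.
    by move: ax; apply: cvgr_gt; exact: dist2_continuous.
  by move: xb; apply: cvgr_lt; exact: dist2_continuous.
have ch : continuous h.
  move=> x; apply: (@continuousM _ _ (cst m) (fun x => expR (- al * dist2 x c) - expR (- al * b))).
    exact: cst_continuous.
  apply: (@continuousB _ _ _ (fun x => expR (- al * dist2 x c)) (cst (expR (- al * b)))).
    apply: (@continuous_comp _ _ _ (fun x => - al * dist2 x c) expR); last exact: continuous_expR.
    by apply: (@continuousM _ _ (cst (- al)) (fun x => dist2 x c)); [exact: cst_continuous|exact: dist2_continuous].
  exact: cst_continuous.
have bd x : K x -> ~ U x -> h x <= psi x.
  move=> Kx /negP; rewrite negb_and -!leNgt => /orP[xa|bx].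
    have {}xa : dist2 x c = a by apply/eqP; rewrite eq_le xa; case/andP: Kx.
    rewrite (le_trans _ (Hm _ xa))// /h ler_piMr ?(ltW m0)//.
    rewrite lerBlDr (@le_trans _ _ 1)//; last by rewrite lerDl expR_ge0.
    by rewrite -expR0 ler_expR mulNr oppr_le0 mulr_ge0 ?ltW// xa.
  have {}bx : dist2 x c = b by apply/eqP; rewrite eq_le bx andbT; case/andP: Kx.
  by rewrite /h bx subrr mulr0; exact: psi0.
have lh x : U x -> exists2 L, has_lap h x L & C * h x <= L.
  move=> /andP[/ltW ax /ltW xb].
  have hg := has_lapZ m (has_lap_gauss al x c).
  have hc : has_lap (fun _ => m * - expR (- al * b)) x 0.
    exists (fun=> 0); split; last by rewrite big1.
    move=> k; exists (fun=> 0); split; last exact: is_derive_cst.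
    by near=> t; exact: is_derive_cst.
  have := has_lapD hg hc; rewrite addr0.
  have -> : (fun z => m * expR (- al * dist2 z c) + m * - expR (- al * b)) = h.
    by apply/funext => z; rewrite /h mulrDr.
  move=> hL; eexists; first exact: hL.
  rewrite /h mulrCA ler_pM2l//.
  apply: (@le_trans _ _ (C * expR (- al * dist2 x c))).
    by rewrite ler_pM2l// gerBl expR_ge0.
  rewrite ler_pM2r ?expR_gt0// (le_trans alC)// lerD2r ler_pM2l//.
  by rewrite mulr_gt0// exprn_gt0.
have main x : K x -> x != z0 -> h x <= psi x.
  exact: (@comparison_punctured R N N2 K U C z0 h psi).
move=> x Kx; have [xz|] := eqVneq x z0; last exact: main.
have [Ux|nUx] := pselect (U x); last exact: bd.
rewrite -subr_le0; apply: (@le0_punctured x (fun x => h x - psi x)).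
  by apply: continuousB; [exact: ch|exact: cpsi].
apply: filterS (UK _ Ux) => z Kz zx; rewrite subr_le0; apply: main => //.
by rewrite -xz.
Unshelve. all: by end_near. Qed.

Section HalfSpace.
Variables (e : 'rV[R]_N) (l : R) (z0 : 'rV[R]_N) (psi : 'rV[R]_N -> R).
Hypotheses (e1 : dot e e = 1) (cpsi : continuous psi).
Hypothesis psi_ge0 : forall x, l <= dot x e -> 0 <= psi x.
Hypothesis psi_super : forall p b, exists2 C, 0 < C & forall x, l < dot x e ->
  dist2 x p <= b -> x != z0 -> exists2 L, has_lap psi x L & L <= C * psi x.

Lemma dist_plane p x : dot p e - dot x e <= enorm (x - p).
Proof.
have <- : dot (p - x) e = dot p e - dot x e by rewrite !dotE.
by rewrite -enormN opprB; exact: le_dot_enorm.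
Qed.

Lemma tangent_ball_barrier p : l < dot p e -> 0 < psi p ->
  exists a m al, [/\ a < (dot p e - l) ^+ 2, 0 < m, 0 < al,
    forall x, dist2 x p <= a -> 0 < psi x &
    forall x, a <= dist2 x p <= (dot p e - l) ^+ 2 ->
      m * (expR (- al * dist2 x p) - expR (- al * (dot p e - l) ^+ 2)) <= psi x].
Proof.
move=> lp psip; set b := (dot p e - l) ^+ 2.
have lp0 : 0 < dot p e - l by rewrite subr_gt0.
have b0 : 0 < b by rewrite exprn_gt0.
have np : \forall z \near p, 0 < psi z by have := @cpsi p => /cvgr_gt; apply.
have [a1 a10 Ha1] := near_dist2 np.
pose a := Num.min a1 (b / 2).
have a0 : 0 < a by rewrite lt_min a10 divr_gt0.
have ab : a < b by rewrite gt_min ltr_pdivrMr// ltr_pMr// ltr1n orbT.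
have Ha x : dist2 x p <= a -> 0 < psi x.
  by move=> xa; apply: Ha1; rewrite (le_trans xa)// ge_min lexx.
have closedin x : dist2 x p <= b -> l <= dot x e.
  rewrite /dist2 -sqr_enorm ler_sqr ?nnegrE ?enorm_ge0 ?(ltW lp0)// => H.
  have := le_trans (dist_plane p x) H; lra.
have openin x : dist2 x p < b -> l < dot x e.
  rewrite /dist2 -sqr_enorm ltr_sqr ?nnegrE ?enorm_ge0 ?(ltW lp0)// => H.
  have := le_lt_trans (dist_plane p x) H; lra.
have [C C0 HC] := psi_super p b.
have [|||m [al [m0 al0 H]]] := @annulus_barrier a b C z0 p psi a0 ab C0 cpsi.
- by move=> x /andP[_ xb]; apply/psi_ge0/closedin.
- by move=> x xa; apply: Ha; rewrite xa.
- by move=> x /andP[_ xb] xz; apply: HC => //; [exact: openin|exact: ltW].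
by exists a, m, al.
Qed.

Lemma positive_tangent_ball p x : l < dot p e -> 0 < psi p ->
  dist2 x p < (dot p e - l) ^+ 2 -> 0 < psi x.
Proof.
move=> lp /(tangent_ball_barrier lp)[a [m [al [ab m0 al0 Ha Hb]]]] xb.
have [/Ha//|ax] := leP (dist2 x p) a.
apply: lt_le_trans (Hb x _); last by rewrite !ltW.
by rewrite mulr_gt0// subr_gt0 ltr_expR !mulNr ltrN2 ltr_pM2l.
Qed.

(* The tangent balls centred at p + t e exhaust the half-space. *)
Lemma half_space_positive p x : l < dot p e -> 0 < psi p -> l < dot x e -> 0 < psi x.
Proof.
move=> lp psip lx; pose d := dot p e - l.
have d0 : 0 < d by rewrite subr_gt0.
have pt (t : R) : dot (p + t *: e) e - l = d + t by rewrite !dotE e1 /d; ring.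
have ray n : forall s, 0 <= s -> s <= n%:R * (d / 2) -> 0 < psi (p + s *: e).
  elim: n => [|n IH] s s0 sn.
    rewrite mul0r in sn; have -> : s = 0 by apply/eqP; rewrite eq_le sn.
    by rewrite scale0r addr0.
  pose t := Num.max (s - d / 2) 0.
  have t0 : 0 <= t by rewrite le_max lexx orbT.
  have tn : t <= n%:R * (d / 2).
    rewrite ge_max mulr_ge0 ?divr_ge0 ?(ltW d0)// andbT lerBlDr.
    by rewrite -[X in _ + X]mul1r -mulrDl natr1.
  have st : `|s - t| <= d / 2.
    rewrite /t; case: (leP (s - d / 2) 0) => H; last by rewrite opprB addrC subrK ger0_norm// divr_ge0// ltW.
    by rewrite subr0 ger0_norm//; lra.
  apply: positive_tangent_ball (IH t t0 tn) _; first by rewrite -subr_gt0 pt ltr_wpDr.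
  rewrite pt /dist2 opprD addrACA subrr add0r -scalerBl !dotE e1 mulr1 -expr2.
  rewrite -real_normK ?num_real// ltr_sqr ?nnegrE ?(addr_ge0 (ltW d0) t0)//.
  by rewrite (le_lt_trans st)//; lra.
have dx : 0 < dot x e - l by rewrite subr_gt0.
pose Q := `|dist2 x p - d ^+ 2| / (2 * (dot x e - l)) + 1.
have Q0 : 0 < Q by rewrite ltr_wpDl// divr_ge0// mulr_ge0// ltW.
have psiQ : 0 < psi (p + Q *: e).
  have [k Qk] : exists k : nat, Q / (d / 2) < k%:R.
    by exists (Num.bound (Q / (d / 2))); rewrite archi_boundP// divr_ge0 ?divr_ge0 ?ltW.
  by apply: (ray k); rewrite ?(ltW Q0)// -ler_pdivrMr ?divr_gt0// ltW.
apply: positive_tangent_ball psiQ _; first by rewrite -subr_gt0 pt addr_gt0.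
rewrite pt.
have -> : dist2 x (p + Q *: e) = dist2 x p - 2 * Q * (dot x e - dot p e) + Q ^+ 2.
  by rewrite /dist2 !dotE e1 (dotC p x) (dotC e x) (dotC e p); ring.
have HQ : `|dist2 x p - d ^+ 2| < Q * (2 * (dot x e - l)).
  by rewrite -ltr_pdivrMr ?mulr_gt0// ltrDl.
have := le_lt_trans (ler_norm _) HQ.
by rewrite sqrrD -mulr_natl /d; lra.
Qed.

Lemma hopf p x : l < dot p e -> 0 < psi p -> dot x e = l ->
  exists k d, [/\ 0 < k, 0 < d & forall t, 0 <= t <= d -> k * t <= psi (x + t *: e)].
Proof.
move=> lp psip xl.
have ce : dot (x + 1 *: e) e - l = 1 by rewrite !dotE e1 xl; ring.
have lc : l < dot (x + 1 *: e) e by rewrite -subr_gt0 ce.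
have [a [m [al [a1 m0 al0 _ H]]]] := tangent_ball_barrier lc (half_space_positive lp psip lc).
rewrite ce expr1n in a1 H.
exists (m * (expR (- al * 1) * al)), (Num.min 1 ((1 - a) / 2)).
have a10 : 0 < 1 - a by rewrite subr_gt0.
split; [by rewrite !mulr_gt0// expR_gt0|by rewrite lt_min ltr01 divr_gt0|].
move=> t /andP[t0]; rewrite le_min => /andP[t1 ta].
have E : dist2 (x + t *: e) (x + 1 *: e) = (1 - t) ^+ 2.
  by rewrite /dist2 opprD addrACA subrr add0r -scalerBl !dotE e1; ring.
have tt : t * t <= t by rewrite -[leRHS]mul1r ler_wpM2r.
have {}H := H (x + t *: e) _; rewrite E in H.
apply: le_trans (H _); last by apply/andP; split; nra.
rewrite -mulrA ler_pM2l//.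
have -> : - al * (1 - t) ^+ 2 = - al * 1 + al * (t * (2 - t)) by ring.
rewrite expRD -[X in _ - X]mulr1 -mulrBr -mulrA ler_pM2l ?expR_gt0//.
have := expR_ge1Dx (al * (t * (2 - t))) => HE.
have : al * t <= al * (t * (2 - t)) by rewrite ler_pM2l//; nra.
lra.
Qed.

End HalfSpace.
End HopfLemma.

(** * Moving planes *)

Section MovingPlanes.
Context {R : realType} {N : nat}.
Hypothesis N2 : (2 <= N)%N.
Variables (V : R -> R) (u : 'rV[R]_N -> R).
Hypotheses
  (V_increasing : {in `]0, +oo[ &, {homo V : r s / r <= s}})
  (V_nonconstant : exists r s : R, [/\ 0 < r, 0 < s & V r != V s])
  (u_continuous : continuous u)
  (u_C2 : C2_on [set x | x != 0] u)
  (u_equation : forall x : 'rV[R]_N, x != 0 ->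
     - laplacian u x + V (enorm x) * u x = u x * ln (u x ^+ 2))
  (u_positive : forall x : 'rV[R]_N, 0 < u x)
  (u_decay : vanishes_at_infinity u).
Implicit Types (x y z p e : 'rV[R]_N) (l r s t : R).

Definition refl_diff e l x := u (refl e l x) - u x.

Let V_le r s : 0 < r -> r <= s -> V r <= V s.
Proof.
by move=> r0 rs; apply: V_increasing => //; rewrite in_itv/= andbT// (lt_le_trans r0).
Qed.

Let open_neq0 x : [set x : 'rV[R]_N | x != 0] x -> \forall z \near x, [set x | x != 0] z.
Proof. exact: near_neq. Qed.

Let pos_neq0 x e : 0 < dot x e -> x != 0.
Proof. by apply: contraTneq => ->; rewrite dot0l ltxx. Qed.

Lemma laplacian_u x : x != 0 -> laplacian u x = V (enorm x) * u x - 2 * u x * ln (u x).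
Proof.
by move=> /u_equation; rewrite lnXn// -mulr_natl; lra.
Qed.

Lemma refl_diff_continuous e l : continuous (refl_diff e l).
Proof.
move=> x; apply: (@continuousB _ _ _ (u \o refl e l) u); last exact: u_continuous.
by apply: continuous_comp; [exact: refl_continuous|exact: u_continuous].
Qed.

Lemma refl_diff_continuous2 e x l :
  (fun p : 'rV[R]_N * R => refl_diff e p.2 p.1) @ (x, l) --> refl_diff e l x.
Proof.
apply: cvgB.
  by apply: continuous_cvg; [exact: u_continuous|exact: refl_continuous2].
by apply: continuous_cvg; [exact: u_continuous|exact: cvg_fst].
Qed.

Lemma refl_diff_plane e l x : dot x e = l -> refl_diff e l x = 0.
Proof. by move=> xl; rewrite /refl_diff refl_fix// subrr. Qed.

Lemma enorm_refl_le e l x : dot e e = 1 -> 0 < l -> l < dot x e ->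
  enorm (refl e l x) <= enorm x.
Proof.
move=> e1 l0 lx; rewrite ler_enorm dot_refl_refl// gerBl.
by rewrite !mulr_ge0// ?subr_ge0 ltW.
Qed.

Lemma refl_neq0 e l x : dot e e = 1 -> x != refl e l 0 -> refl e l x != 0.
Proof. by move=> e1; apply: contra_neq => x0; rewrite -x0 reflK. Qed.

Lemma has_lap_refl_diff e l x : dot e e = 1 -> 0 < l -> l < dot x e -> x != refl e l 0 ->
  has_lap (refl_diff e l) x (laplacian u (refl e l x) - laplacian u x).
Proof.
move=> e1 l0 lx xr; apply: has_lapB.
  by apply: (has_lap_refl open_neq0 u_C2 e1); exact: refl_neq0.
by apply: (has_laplacian open_neq0 u_C2); apply: (@pos_neq0 x e); exact: lt_trans lx.
Qed.

(* f s = s log s^2 is convex, so f b - f a >= f' a * (b - a) with a = u x and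
   b = u (refl e l x). *)
Lemma laplacian_refl_diff_le e l x : dot e e = 1 -> 0 < l -> l < dot x e -> x != refl e l 0 ->
  laplacian u (refl e l x) - laplacian u x <=
    (V (enorm x) - 2 * ln (u x) - 2) * refl_diff e l x.
Proof.
move=> e1 l0 lx xr; have rx0 := refl_neq0 e1 xr.
have x0 : x != 0 by apply: (@pos_neq0 x e); exact: lt_trans lx.
rewrite !laplacian_u// /refl_diff.
set a := u x; set b := u (refl e l x).
have a0 : 0 < a := u_positive _; have b0 : 0 < b := u_positive _.
have Vb : V (enorm (refl e l x)) * b <= V (enorm x) * b.
  by rewrite ler_pM2r// V_le ?enorm_gt0// enorm_refl_le.
have Hln : b * (ln a - ln b) <= a - b.
  rewrite -ln_div ?posrE//.
  have := @le_ln1Dx R (a / b - 1); rewrite addrCA subrr addr0.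
  have ab0 : 0 < a / b by rewrite divr_gt0.
  rewrite ltrBDr addrC subrr => /(_ ab0) H.
  have : b * ln (a / b) <= b * (a / b - 1) by rewrite ler_pM2l.
  by rewrite mulrBr mulr1 mulrCA divff ?gt_eqF// mulr1.
by rewrite (le_trans (lerB (lerB Vb (lexx _)) (lexx _)))//; nra.
Qed.

Lemma refl_diff_super e l p (b : R) : dot e e = 1 -> 0 < l ->
  (forall x, l <= dot x e -> 0 <= refl_diff e l x) ->
  exists2 C, 0 < C & forall x, l < dot x e -> dist2 x p <= b -> x != refl e l 0 ->
    exists2 L, has_lap (refl_diff e l) x L & L <= C * refl_diff e l x.
Proof.
move=> e1 l0 phi0.
have [[y yb]|B0] := pselect ([set x | dist2 x p <= b] !=set0); last first.
  by exists 1 => // x _ xb; case: B0; exists x.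
have cB : compact [set x : 'rV[R]_N | dist2 x p <= b].
  apply: (@compact_dist2 _ _ p b) => //.
  by apply: (@preimage_closed _ _ (dist2 ^~ p) [set x | x <= b]);
    [move=> x _; exact: dist2_continuous|exact: closed_le].
have [xm _ Hm] := min_on_compact cB (ex_intro _ y yb) u_continuous.
pose v := V (enorm p + Num.sqrt b).
exists (`|v - 2 * ln (u xm) - 2| + 1); first by rewrite ltr_wpDl.
move=> x lx xb xr; exists (laplacian u (refl e l x) - laplacian u x); first exact: has_lap_refl_diff.
rewrite (le_trans (laplacian_refl_diff_le e1 l0 lx xr))// ler_wpM2r// ?phi0 ?(ltW lx)//.
have x0 : x != 0 by apply: (@pos_neq0 x e); exact: lt_trans lx.
have Vv : V (enorm x) <= v.
  apply: V_le; first by rewrite enorm_gt0.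
  rewrite -{1}(subrK p x) addrC (le_trans (enormD _ _))// lerD2l enormE.
  by rewrite ler_sqrt// (le_trans (dist2_ge0 x p)).
have lnm : ln (u xm) <= ln (u x) by rewrite ler_ln ?posrE// Hm.
have := ler_norm (v - 2 * ln (u xm) - 2); lra.
Qed.

Lemma refl_diff_not_identically_0 e l : dot e e = 1 -> 0 < l ->
  exists2 p, l < dot p e & refl_diff e l p != 0.
Proof.
move=> e1 l0; apply: contrapT => H.
have phi0 x : l < dot x e -> refl_diff e l x = 0.
  by move=> lx; apply/eqP; apply: contrapT => /negP px; apply: H; exists x.
have per r : 0 < r -> V (r + 2 * l) = V r.
  move=> r0; pose x := (r + 2 * l) *: e.
  have xe : dot x e = r + 2 * l by rewrite dotZl e1 mulr1.
  have lx : l < dot x e by rewrite xe; lra.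
  have rx : refl e l x = (- r) *: e.
    by rewrite /refl xe /x -scalerBl; congr (_ *: _); ring.
  have xr : x != refl e l 0.
    apply: contraTneq r0 => x0; move: rx; rewrite x0 reflK// => /esym/eqP.
    rewrite scaler_eq0 oppr_eq0 => /orP[/eqP->|/eqP e0]; first by rewrite ltxx.
    by move: e1; rewrite e0 dot0l => /eqP; rewrite eq_sym oner_eq0.
  have near0 : \forall z \near x, refl_diff e l z = 0.
    have : \forall z \near x, l < dot z e by have := @dot_continuous R N e x => /cvgr_gt; apply.
    by apply: filterS => z; exact: phi0.
  have hL := has_lap_refl_diff e1 l0 lx xr.
  have L0 : laplacian u (refl e l x) - laplacian u x = 0.
    apply/eqP; rewrite eq_le; apply/andP; split.
      apply: (has_lap_max hL); apply: filterS near0 => z ->.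
      by rewrite phi0.
    rewrite -oppr_le0 -mulN1r; apply: (has_lap_max (has_lapZ (-1) hL)).
    by apply: filterS near0 => z ->; rewrite phi0.
  have rx0 := refl_neq0 e1 xr.
  have x0 : x != 0 by apply: (@pos_neq0 x e); exact: lt_trans lx.
  move: L0; rewrite !laplacian_u//.
  have -> : u (refl e l x) = u x by apply/eqP; rewrite -subr_eq0 -/(refl_diff e l x) phi0.
  have ee : enorm e = 1 by rewrite enormE e1 sqrtr1.
  rewrite rx !enormZ ee !mulr1 normrN !ger0_norm ?(ltW r0)//; last by rewrite addr_ge0 ?mulr_ge0 ?ltW.
  move=> E; have : (V r - V (r + 2 * l)) * u x = 0 by lra.
  by move/eqP; rewrite mulf_eq0 (gt_eqF (u_positive x)) orbF subr_eq0 eq_sym => /eqP.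
have pern n r : 0 < r -> V (r + n%:R * (2 * l)) = V r.
  move=> r0; elim: n => [|n IH]; first by rewrite mul0r addr0.
  rewrite -natr1 mulrDl mul1r addrA per ?IH// ltr_wpDr// !mulr_ge0// ltW//.
have cst r s : 0 < r -> r <= s -> V r = V s.
  move=> r0 rs; apply/eqP; rewrite eq_le V_le//=.
  pose n := Num.bound (s / (2 * l)).
  rewrite -(pern n r r0) V_le ?(lt_le_trans r0 rs)//.
  have := archi_boundP (_ : 0 <= s / (2 * l)); rewrite -/n => H1.
  have {}H1 := H1 (divr_ge0 (ltW (lt_le_trans r0 rs)) (mulr_ge0 (ler0n _ 2) (ltW l0))).
  move: H1; rewrite ltr_pdivrMr ?mulr_gt0// => H1; lra.
have [r [s [r0 s0 /eqP]]] := V_nonconstant; apply.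
by have [rs|/ltW sr] := leP r s; [exact: cst|rewrite (cst s r)].
Qed.

Section Nonneg.
Variables (e : 'rV[R]_N) (l : R).
Hypotheses (e1 : dot e e = 1) (l0 : 0 < l).
Hypothesis refl_diff_ge0 : forall x, l < dot x e -> 0 <= refl_diff e l x.

Let refl_diff_half_space_ge0 x : l <= dot x e -> 0 <= refl_diff e l x.
Proof.
rewrite le_eqVlt => /orP[/eqP/esym/refl_diff_plane->//|]; exact: refl_diff_ge0.
Qed.

Let super p (b : R) := refl_diff_super p b e1 l0 refl_diff_half_space_ge0.

Lemma refl_diff_gt0 x : l < dot x e -> 0 < refl_diff e l x.
Proof.
have [p lp pp] := refl_diff_not_identically_0 e1 l0.
apply: (half_space_positive N2 e1 (refl_diff_continuous (l := l)) refl_diff_half_space_ge0 super lp).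
by rewrite lt0r pp refl_diff_ge0.
Qed.

Lemma dir_lt0 x : dot x e = l -> dir_deriv u e x < 0.
Proof.
move=> xl; have [p lp pp] := refl_diff_not_identically_0 e1 l0.
have pp0 : 0 < refl_diff e l p by rewrite lt0r pp refl_diff_ge0.
have [k [d [k0 d0 H]]] := hopf N2 e1 (refl_diff_continuous (l := l)) refl_diff_half_space_ge0 super lp pp0 xl.
have x0 : [set x | x != 0] x by apply: (@pos_neq0 x e); rewrite xl.
have D v : is_derive (0 : R) 1 (fun t : R => u (x + t *: v)) (dir_deriv u v x).
  have := @is_derive_dir R N u _ open_neq0 u_C2 x v 0; rewrite scale0r addr0; exact.
pose F t := u (x + t *: - e) - u (x + t *: e).
have DF : is_derive (0 : R) 1 F (dir_deriv u (- e) x - dir_deriv u e x) by exact: is_deriveB.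
have FE t : F t = refl_diff e l (x + t *: e).
  rewrite /F /refl_diff refl_line refl_fix// e1 mulr1.
  by have -> : e - 2 *: e = - e by rewrite scaler_nat mulr2n opprD addrA subrr add0r.
have dN : dir_deriv u (- e) x = - dir_deriv u e x.
  by rewrite /dir_deriv -sumrN; apply: eq_bigr => i _; rewrite mxE mulNr.
rewrite dN in DF; suff : k <= - dir_deriv u e x - dir_deriv u e x by move=> ?; lra.
set m := (_ - _) in DF *; rewrite leNgt; apply/negP => mk.
have [cF1 EF1] := DF.
have /cvgrPdist_lt/(_ (k - m)) : h^-1 *: ((F \o shift 0) (h *: 1) - F 0) @[h --> (0:R)^'] --> m.
  by rewrite -EF1; exact: cF1.
rewrite subr_gt0 => /(_ mk); rewrite near_withinE => /nbhs_ballP[d' d'0 Hd'].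
pose t := Num.min d d' / 2.
have t0 : 0 < t by rewrite divr_gt0// lt_min d0.
have tm : t < Num.min d d' by rewrite /t ltr_pdivrMr// ltr_pMr ?ltr1n// lt_min d0.
have td : t < d by rewrite (lt_le_trans tm)// ge_min lexx.
have td' : t < d' by rewrite (lt_le_trans tm)// ge_min lexx orbT.
have := Hd' t; rewrite /ball/= sub0r normrN gtr0_norm// => /(_ td' (lt0r_neq0 t0)).
have F0 : F 0 = 0 by rewrite /F !scale0r subrr.
rewrite /= [t%:A]mulr1 addr0 F0 subr0 distrC ltr_norml => /andP[_].
rewrite ltrBlDr subrK -[_ *: _]/(_ * _) mulrC ltr_pdivrMr// ltNge.
by rewrite FE H// (ltW t0) ltW.
Qed.

End Nonneg.

Lemma negative_point_bounded : exists R0 : R, forall e l, dot e e = 1 -> 0 < l ->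
  (exists2 x, l < dot x e & refl_diff e l x < 0) ->
  exists x, [/\ l < dot x e, enorm x < R0 & refl_diff e l x < 0].
Proof.
pose a := Num.min (expR (V 1 / 2 - 1)) (u 0).
have a0 : 0 < a by rewrite lt_min expR_gt0 u_positive.
have [M1 HM1] := u_decay a0.
exists (Num.max 1 M1) => e l e1 l0 [x0 lx0 px0].
have [M HM] : exists M, forall x, M <= enorm x -> `|u x| < - refl_diff e l x0.
  by apply: u_decay; rewrite oppr_gt0.
pose M' := Num.max M (enorm x0).
have M'0 : 0 <= M' by rewrite le_max enorm_ge0 orbT.
pose K := [set x | l <= dot x e] `&` [set x | dist2 x 0 <= M' ^+ 2].
have dist20 x : dist2 x 0 = enorm x ^+ 2 by rewrite sqr_enorm /dist2 subr0.
have cK : compact K.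
  apply: (@compact_dist2 _ _ 0 (M' ^+ 2)); last by move=> x [].
  apply: closedI.
    by apply: (@preimage_closed _ _ (dot ^~ e) [set x | l <= x]);
      [move=> x _; exact: dot_continuous|exact: closed_ge].
  by apply: (@preimage_closed _ _ (dist2 ^~ 0) [set x | x <= M' ^+ 2]);
    [move=> x _; exact: dist2_continuous|exact: closed_le].
have Kx0 : K x0.
  split; first exact: ltW.
  by rewrite /= dist20 ler_sqr ?nnegrE ?enorm_ge0// le_max lexx orbT.
have [x [/= lx xM] Hx] := min_on_compact cK (ex_intro _ x0 Kx0) (refl_diff_continuous (e := e) (l := l)).
have px : refl_diff e l x < 0 by rewrite (le_lt_trans (Hx _ Kx0)).
have {}lx : l < dot x e.
  rewrite lt_neqAle lx andbT; apply: contraTneq px => /esym/refl_diff_plane->.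
  by rewrite ltxx.
have {}xM : dist2 x 0 < M' ^+ 2.
  rewrite dist20 ltr_sqr ?nnegrE ?enorm_ge0//.
  apply: (@lt_le_trans _ _ M); last by rewrite le_max lexx.
  rewrite ltNge; apply/negP => /HM; rewrite gtr0_norm// => ux.
  have := Hx _ Kx0; rewrite {1}/refl_diff; have := u_positive (refl e l x); lra.
exists x; split => //; rewrite ltNge; apply/negP; rewrite ge_max => /andP[x1 /HM1].
rewrite gtr0_norm// lt_min => /andP[uexp uu0].
have [xr|xr] := eqVneq x (refl e l 0).
  by move: px; rewrite /refl_diff {1}xr reflK// subr_lt0 ltNge ltW.
have hL := has_lap_refl_diff e1 l0 lx xr.
have : -1 * (laplacian u (refl e l x) - laplacian u x) <= 0.
  apply: (has_lap_max (has_lapZ (-1) hL)).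
  have nl : \forall z \near x, l < dot z e by have := @dot_continuous R N e x => /cvgr_gt; apply.
  have nM : \forall z \near x, dist2 z 0 < M' ^+ 2 by have := @dist2_continuous R N 0 x => /cvgr_lt; apply.
  near=> z; rewrite !mulN1r lerN2; apply: Hx; split; apply/ltW; near: z; [exact: nl|exact: nM].
have := laplacian_refl_diff_le e1 l0 lx xr.
have : 0 < V (enorm x) - 2 * ln (u x) - 2.
  have V1 : V 1 <= V (enorm x) by exact: V_le.
  have : ln (u x) < V 1 / 2 - 1 by rewrite -[ltRHS]expRK ltr_ln ?posrE ?expR_gt0.
  lra.
by nra.
Unshelve. all: by end_near. Qed.

Lemma near_plane_nonneg e l x : dot e e = 1 -> x != 0 -> dir_deriv u e x < 0 -> dot x e = l ->
  \forall z \near x & s \near l, s < dot z e -> 0 <= refl_diff e s z.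
Proof.
move=> e1 x0 dx xl.
have [d d0 Hd] : exists2 d, 0 < d & forall z, `|z - x| < d -> z != 0 /\ dir_deriv u e z < 0.
  have nd : \forall z \near x, dir_deriv u e z < 0.
    by have := @dir_continuous R N u _ u_C2 e x x0 => /cvgr_lt; apply.
  have /nbhs_ballP[d d0 Hd] : \forall z \near x, z != 0 /\ dir_deriv u e z < 0.
    by near=> z; split; near: z; [exact: near_neq|exact: nd].
  exists d => // z zd; apply: Hd; by rewrite -ball_normE /ball_/= distrC.
have n1 : \forall p \near (x, l), `|refl e p.2 p.1 - x| < d / 3.
  have cr : refl e p.2 p.1 @[p --> (x, l)] --> refl e l x := @refl_continuous2 R N e x l.
  rewrite refl_fix// in cr; have := @cvgr_distC_lt _ _ _ _ _ _ _ cr (d / 3).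
  by apply; rewrite divr_gt0.
have n2 : \forall p \near (x, l), `|p.1 - x| < d / 3.
  have : p.1 @[p --> (x, l)] --> x by exact: cvg_fst.
  by move=> cf; have := @cvgr_distC_lt _ _ _ _ _ _ _ cf (d / 3); apply; rewrite divr_gt0.
suff : \forall p \near (x, l), p.2 < dot p.1 e -> 0 <= refl_diff e p.2 p.1 by [].
near=> p => pe.
have c1 : `|refl e p.2 p.1 - x| < d / 3 by near: p.
have c2 : `|p.1 - x| < d / 3 by near: p.
move: (p.1) (p.2) pe c1 c2 => z s pe c1 c2.
set y := refl e s z in c1; pose T := 2 * (dot z e - s).
have T0 : 0 < T by rewrite mulr_gt0// subr_gt0.
have zE : z = y + T *: e by rewrite /y /refl subrK.
have close c : `|c| <= `|T| -> `|y + c *: e - x| < d.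
  move=> cT; rewrite addrAC (le_lt_trans (ler_normD _ _))//.
  apply: (@le_lt_trans _ _ (`|y - x| + `|z - y|)).
    by rewrite lerD2l zE addrAC subrr add0r (normrZ c) (normrZ T) ler_wpM2r.
  rewrite -[z - y](subrKA x); apply: (@le_lt_trans _ _ (`|y - x| + (`|z - x| + `|x - y|))).
    by rewrite lerD2l ler_normD.
  rewrite (distrC x y); lra.
have [|c cT] := @mean_value_at0 R (fun t => u (y + t *: e)) (fun t => dir_deriv u e (y + t *: e)) T.
  by move=> t /close/Hd[z0 _]; exact: (is_derive_dir open_neq0 u_C2).
rewrite scale0r addr0 -zE => E.
have [_ dc] := Hd _ (close _ cT).
rewrite /refl_diff -/y -oppr_le0 opprB E.
by rewrite mulr_le0_ge0// ltW.
Unshelve. all: by end_near. Qed.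

Lemma refl_diff_nonneg e l x : dot e e = 1 -> 0 < l -> l < dot x e -> 0 <= refl_diff e l x.
Proof.
move=> e1 l0 lx; rewrite leNgt; apply/negP => px.
have [R0 HR0] := negative_point_bounded.
pose S := [set s : R | 0 < s /\ exists2 x, s < dot x e & refl_diff e s x < 0].
have Sl : S l by split => //; exists x.
have ubS s : S s -> s <= R0.
  move=> [s0 /(HR0 _ _ e1 s0)[y [sy yR _]]].
  by rewrite ltW// (lt_trans sy)// (le_lt_trans _ yR)// le_dot_enorm.
have supS : has_sup S by split; [exists l|exists R0].
pose la := sup S.
have lla : l <= la by apply: ub_le_sup => //; case: supS.
have la0 : 0 < la := lt_le_trans l0 lla.
have phila y : la < dot y e -> 0 <= refl_diff e la y.
  move=> ly; rewrite leNgt; apply/negP => py.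
  have n1 : \forall s \near la, refl_diff e s y < 0.
    have cc : {for la, continuous (fun s => refl_diff e s y)}.
      apply: (@continuousB _ _ _ (fun s => u (refl e s y)) (cst (u y))); last exact: cst_continuous.
      apply: (@continuous_comp _ _ _ (fun s => refl e s y) u); last exact: u_continuous.
      exact: refl_continuous_level.
    by move: cc => /cvgr_lt; apply.
  have n2 : \forall s \near la, s < dot y e by apply: (cvgr_lt _ cvg_id).
  have /nbhs_ballP[d d0 Hd] : \forall s \near la, refl_diff e s y < 0 /\ s < dot y e.
    by near=> s; split; near: s.
  have [|ps sy] := Hd (la + d / 2).
    by rewrite /ball/= opprD addrA subrr sub0r normrN gtr0_norm ?divr_gt0// ltr_pdivrMr// ltr_pMr// ltr1n.
  have d2 : 0 < d / 2 by rewrite divr_gt0.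
  have : la + d / 2 <= la.
    by apply: ub_le_sup; [case: supS|split; [exact: addr_gt0|exists y]].
  lra.
have phila0 := refl_diff_gt0 e1 la0 phila.
have cB : compact [set y : 'rV[R]_N | dist2 y 0 <= R0 ^+ 2].
  apply: (@compact_dist2 _ _ 0 (R0 ^+ 2)) => //.
  by apply: (@preimage_closed _ _ (dist2 ^~ 0) [set x | x <= R0 ^+ 2]);
    [move=> z _; exact: dist2_continuous|exact: closed_le].
move/compact_near_coveringP : cB => /(_ R (nbhs la) (fun s z => s < dot z e -> 0 <= refl_diff e s z) _).
case=> [y _|]; last first.
  move=> d /= d0 Hd.
  have [s Ss ds] := sup_adherent d0 supS.
  have sla : s <= la by apply: ub_le_sup => //; case: supS.
  have [s0 /(HR0 _ _ e1 s0)[z [sz zR pz]]] := Ss.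
  have zB : dist2 z 0 <= R0 ^+ 2.
    rewrite /dist2 subr0 -sqr_enorm ler_sqr ?nnegrE ?enorm_ge0 ?ltW//.
    by rewrite (le_lt_trans _ zR)// enorm_ge0.
  have := Hd s _ z zB sz; rewrite leNgt pz => /(_ _)/negP; apply => //=.
  by rewrite ger0_norm ?subr_ge0//; rewrite -/la in ds; lra.
have [ye|ye|ye] := ltgtP (dot y e) la.
- pose m := (dot y e + la) / 2.
  have n1 : \forall z \near y, dot z e < m.
    by have := @dot_continuous R N e y => /cvgr_lt; apply; rewrite /m; lra.
  have n2 : \forall s \near la, m < s by apply: lt_nbhsr; rewrite /m; lra.
  near=> z s => sz.
  have zm : dot z e < m by near: z.
  have ms : m < s by near: s.
  by have := lt_trans (lt_trans zm ms) sz; rewrite ltxx.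
- have cc := @refl_diff_continuous2 e y la.
  have n1 : \forall p \near (y, la), 0 < refl_diff e p.2 p.1.
    by move: cc => /cvgr_gt; apply; exact: phila0.
  have : \forall p \near (y, la), p.2 < dot p.1 e -> 0 <= refl_diff e p.2 p.1.
    by apply: filterS n1 => p /ltW.
  by [].
- apply: near_plane_nonneg => //; first by apply: (@pos_neq0 y e); rewrite ye.
  exact: dir_lt0 ye.
Unshelve. all: by end_near. Qed.

Lemma le_refl0 e x : dot e e = 1 -> 0 < dot x e -> u x <= u (refl e 0 x).
Proof.
move=> e1 xe; rewrite leNgt; apply/negP => ux.
have n1 : \forall s \near (0 : R), u (refl e s x) < u x.
  have cc : {for (0 : R), continuous (fun s => u (refl e s x))}.
    apply: (@continuous_comp _ _ _ (fun s => refl e s x) u); last exact: u_continuous.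
    exact: refl_continuous_level.
  by move: cc => /cvgr_lt; apply.
have n2 : \forall s \near (0 : R), s < dot x e by apply: (cvgr_lt _ cvg_id).
have /nbhs_ballP[d d0 Hd] : \forall s \near (0 : R), u (refl e s x) < u x /\ s < dot x e.
  by near=> s; split; near: s.
have d2 : 0 < d / 2 by rewrite divr_gt0.
have [|us sx] := Hd (d / 2).
  by rewrite /ball/= sub0r normrN gtr0_norm// ltr_pdivrMr// ltr_pMr// ltr1n.
have := refl_diff_nonneg e1 d2 sx; rewrite /refl_diff; lra.
Unshelve. all: by end_near. Qed.

Lemma radial_le x y : enorm x = enorm y -> u x <= u y.
Proof.
move=> xy; have [->//|nxy] := eqVneq x y.
have D0 : 0 < enorm (x - y) by rewrite enorm_gt0 subr_eq0.
set D := enorm (x - y) in D0.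
have DD : D ^+ 2 = 2 * (dot x x - dot x y).
  have := sqr_enorm x; rewrite xy sqr_enorm => xx.
  by rewrite sqr_enorm !dotE (dotC y x) xx; ring.
pose e := D^-1 *: (x - y).
have e1 : dot e e = 1.
  by rewrite /e dotZl dotZr -sqr_enorm -/D; field; rewrite gt_eqF.
have xe : dot x e = D / 2.
  rewrite /e dotZr dotDr dotNr.
  have -> : dot x x - dot x y = D ^+ 2 / 2 by rewrite DD; field.
  by field; rewrite gt_eqF.
have -> : y = refl e 0 x.
  rewrite /refl xe subr0 /e scalerA.
  have -> : 2 * (D / 2) * D^-1 = 1 by field; rewrite gt_eqF.
  by rewrite scale1r opprB addrC subrK.
by apply: le_refl0 => //; rewrite xe divr_gt0.
Qed.

End MovingPlanes.

Theorem theorem1p3 (R : realType) (N : nat) (hN : (2 <= N)%N)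
    (V : R -> R)
    (V_continuous : {in `]0, +oo[, continuous V})
    (V_increasing : {in `]0, +oo[ &, {homo V : r s / r <= s}})
    (V_nonconstant : exists r s : R, [/\ 0 < r, 0 < s & V r != V s])
    (u : 'rV[R]_N -> R)
    (u_continuous : continuous u)
    (u_C2 : C2_on [set x | x != 0] u)
    (u_equation : forall x : 'rV[R]_N, x != 0 ->
       - laplacian u x + V (enorm x) * u x = u x * ln (u x ^+ 2))
    (u_positive : forall x : 'rV[R]_N, 0 < u x)
    (u_decay : vanishes_at_infinity u) :
  exists U : R -> R,
    (forall x : 'rV[R]_N, u x = U (enorm x)) /\
    (forall r : R, 0 < r -> derivable U r 1 /\ derive1 U r < 0).
Proof.
pose e : 'rV[R]_N := delta_mx ord0 (Ordinal (ltnW hN)).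
have e1 : dot e e = 1 by rewrite dot_delta mxE !eqxx.
have le_u := radial_le hN V_increasing V_nonconstant u_continuous u_C2
  u_equation u_positive u_decay.
exists (fun r => u (r *: e)); split=> [x|r r0].
  have xe : enorm x = enorm (enorm x *: e).
    by rewrite enormZ (enormE e) e1 sqrtr1 mulr1 ger0_norm// enorm_ge0.
  by apply/eqP; rewrite eq_le !le_u// -xe.
have open_neq0 x : [set x : 'rV[R]_N | x != 0] x -> \forall z \near x, [set x | x != 0] z.
  exact: near_neq.
have re : dot (r *: e) e = r by rewrite dotZl e1 mulr1.
have re0 : r *: e != 0 by apply: contraTneq r0 => re0; rewrite -re re0 dot0l ltxx.
have D : is_derive r 1 (fun s : R => u (s *: e)) (dir_deriv u e (r *: e)).
  have := @is_derive_dir R N u _ open_neq0 u_C2 0 e r; rewrite add0r => /(_ re0).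
  suff -> : (fun s : R => u (0 + s *: e)) = (fun s => u (s *: e)) by [].
  by apply/funext => s; rewrite add0r.
split; first by case: D.
rewrite derive1E derive_val.
apply: (dir_lt0 hN V_increasing V_nonconstant u_continuous u_C2 u_equation
  u_positive e1 r0 _ re) => x rx.
exact: (refl_diff_nonneg hN V_increasing V_nonconstant u_continuous u_C2 u_equation
  u_positive u_decay e1 r0 rx).
Qed.
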